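(* Let $f:\mathbb R^n\to(-\infty,+\infty]$ and $g:\mathbb R^m\to(-\infty,+\infty]$ be proper lower semicontinuous convex functions and let $A\in\mathbb R^{m\times n}$. Consider the problem $\min_xf(x)+g(Ax)$ and its primal-dual formulation $\min_{x\in\mathbb R^n}\max_{y\in\mathbb R^m}f(x)+\langle Ax,y\rangle-g^*(y)$, and assume the latter has an optimal solution $(v_*,y_* )$. Let $\tau>0$, $\mathcal P=\begin{pmatrix}\frac1\tau I&-A^T\\-A&\tau AA^T\end{pmatrix}$, and let $\{(v_k,y_k)\}_{k=0}^\infty$ be iterates of ADMM with step-size $\tau$. Then for every $k\ge1$: (i) $\mathrm{dist}^2_{\mathcal P^{-}}(0,\mathcal F(v_{k+1},y_{k+1})\cap\mathrm{range}(\mathcal P))\le\mathrm{dist}^2_{\mathcal P^{-}}(0,\mathcal F(v_k,y_k)\cap\mathrm{range}(\mathcal P))$. (ii) $\mathrm{dist}^2_{\mathcal P^{-}}(0,\mathcal F(v_k,y_k)\cap\mathrm{range}(\mathcal P))\le\frac1k\|(v_0,y_0)-(v_*,y_* )\|_{\mathcal P}^2$. (iii) Assume furthermore that there are a constant $\alpha_{\mathcal P}>0$ and a set $\mathbb S\subseteq\mathbb R^{n+m}$ containing $\{(v_k,y_k)\}_{k=0}^\infty$ such that $\alpha_{\mathcal P}\,\mathrm{dist}_{\mathcal P}((v,y),\mathcal F^{-1}(0))\le\mathrm{dist}_{\mathcal P^{-}}(0,\mathcal F(v,y))$ for all $(v,y)\in\mathbb S$. Then for every $k\ge\lceil e/\alpha_{\mathcal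 P}^2\rceil$, $$\mathrm{dist}^2_{\mathcal P^{-}}(0,\mathcal F(v_k,y_k)\cap\mathrm{range}(\mathcal P))\le\exp\left(1-\frac k{\lceil e/\alpha_{\mathcal P}^2\rceil}\right)\mathrm{dist}^2_{\mathcal P^{-}}(0,\mathcal F(v_0,y_0)\cap\mathrm{range}(\mathcal P)).$$
   Context: $f^*,g^*$ are the convex (Fenchel) conjugates; $e$ is Euler's number. ADMM with step-size $\tau$, from initial $(v_0,y_0)\in\mathbb R^n\times\mathbb R^m$, iterates for $k=0,1,\dots$: $$w_{k+1}=\mathrm{argmin}_w\{f^*(w)-\langle A^Ty_k+w,v_k\rangle+\tfrac\tau2\|w+A^Ty_k\|_2^2\},$$ $$v_{k+1}=v_k-\tau(A^Ty_k+w_{k+1}),$$ $$y_{k+1}\in\mathrm{argmin}_y\{g^*(y)-\langle A^Ty+w_{k+1},v_{k+1}\rangle+\tfrac\tau2\|A^Ty+w_{k+1}\|_2^2\};$$ the iterates are assumed to exist (minimizers are attained; $y_{k+1}$ is any minimizer). $\mathcal F(v,y)=\begin{pmatrix}\partial f(v)+A^Ty\\\partial g^*(y)-Av\end{pmatrix}$ with $\partial$ the convex subdifferential, and $\mathcal F^{-1}(0)=\{(v,y):0\in\mathcal F(v,y)\}$; an optimal solution of the primal-dual problem is an element of $\mathcal F^{-1}(0)$. $\mathcal P$ is symmetric positive semidefinite but singular in general; $\mathcal P^-$ is its Moore–Penrose pseudo-inverse and $\mathrm{range}(\mathcal P)$ its range. For positive semidefinite $M$, $\|u\|_M=\sqrt{u^TMu}$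 (a seminorm) and $\mathrm{dist}_M(z,\mathcal S)=\inf_{u\in\mathcal S}\|u-z\|_M$ (equal to $+\infty$ if $\mathcal S=\emptyset$). *)

(* Defs.v *)
From HB Require Import structures.
From mathcomp Require Import all_boot all_order all_algebra.
From mathcomp Require Import all_classical all_reals all_analysis.

Set Implicit Arguments.
Unset Strict Implicit.
Unset Printing Implicit Defensive.

Import Order.TTheory GRing.Theory Num.Theory.
Import numFieldNormedType.Exports.

Local Open Scope classical_set_scope.
Local Open Scope ring_scope.

(* Euclidean geometry on column vectors.  The norm `|x| carried by 'cV[R]_n
   in the library is the sup norm, hence the explicit inner product. *)
Definition dotv (R : realType) (n : nat) (u v : 'cV[R]_n) : R :=
  (u^T *m v) 0 0.

Definition l2norm (R : realType) (n : nat) (u : 'cV[R]_n) : R :=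
  Num.sqrt (dotv u u).

(* A seminorm when M is symmetric positive semidefinite. *)
Definition mxnorm (R : realType) (p : nat) (M : 'M[R]_p) (u : 'cV[R]_p) : R :=
  Num.sqrt (dotv u (M *m u)).

(* The value is +oo when S is empty (ereal_inf set0 = +oo). *)
Definition mxdist (R : realType) (p : nat) (M : 'M[R]_p) (z : 'cV[R]_p)
    (S : set 'cV[R]_p) : \bar R :=
  ereal_inf [set (mxnorm M (u - z))%:E | u in S].

Definition mxrange (R : realType) (p q : nat) (M : 'M[R]_(p, q)) :
    set 'cV[R]_p :=
  range (fun u : 'cV[R]_q => M *m u).

(* The Moore-Penrose pseudo-inverse, specified by the four Penrose equations;
   existence and uniqueness are penrose_mp_pinv and penrose_uniq.  (The
   library's pinvmx is only a one-sided inverse on the row space.) *)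
Definition penrose (R : realType) (p q : nat) (M : 'M[R]_(p, q))
    (X : 'M[R]_(q, p)) : Prop :=
  [/\ M *m X *m M = M,
      X *m M *m X = X,
      (M *m X)^T = M *m X
    & (X *m M)^T = X *m M].

Definition mp_pinv (R : realType) (p q : nat) (M : 'M[R]_(p, q)) :
    'M[R]_(q, p) :=
  xget 0 [set X | penrose M X].

Lemma penrose_uniq (R : realType) (p q : nat) (M : 'M[R]_(p, q))
    (X Y : 'M[R]_(q, p)) : penrose M X -> penrose M Y -> X = Y.
Proof.
move=> [X1 X2 X3 X4] [Y1 Y2 Y3 Y4].
have MXY : M *m X = M *m Y.
  have e1 : (M *m X) *m (M *m Y) = M *m Y by rewrite mulmxA X1.
  have e2 : (M *m Y) *m (M *m X) = M *m X by rewrite mulmxA Y1.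
  by rewrite -e2 -{1}Y3 -{1}X3 -trmx_mul e1.
have XYM : X *m M = Y *m M.
  have e1 : (X *m M) *m (Y *m M) = X *m M by rewrite -mulmxA (mulmxA M) Y1.
  have e2 : (Y *m M) *m (X *m M) = Y *m M by rewrite -mulmxA (mulmxA M) X1.
  by rewrite -e1 -{1}X4 -{1}Y4 -trmx_mul e2.
by rewrite -X2 -mulmxA MXY mulmxA XYM Y2.
Qed.

Lemma gram_unitmx (R : realType) (r q : nat) (B : 'M[R]_(r, q)) :
  row_free B -> B *m B^T \in unitmx.
Proof.
move=> Bfree; rewrite -row_free_unit -kermx_eq0; apply/rowV0P => u.
move=> /sub_kermxP uBB0.
have uB0 : u *m B = 0.
  have : (u *m B) *m (u *m B)^T = 0.
    by rewrite trmx_mul mulmxA -(mulmxA u) uBB0 mul0mx.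
  move=> /matrixP/(_ 0 0); rewrite !mxE => s0.
  apply/rowP => j; rewrite [RHS]mxE; apply/eqP; rewrite -sqrf_eq0 expr2.
  have /psumr_eq0P : \sum_k (u *m B) 0 k * (u *m B) 0 k = 0.
    by rewrite -[RHS]s0; apply: eq_bigr => k _; rewrite [_^T _ _]mxE.
  by move=> -> // k _; rewrite -expr2 sqr_ge0.
by apply: (row_free_inj Bfree); rewrite uB0 mul0mx.
Qed.

Lemma penrose_mp_pinv (R : realType) (p q : nat) (M : 'M[R]_(p, q)) :
  penrose M (mp_pinv M).
Proof.
rewrite /mp_pinv; suff [X PX] : exists X, penrose M X.
  by apply: (@xgetPex _ 0 [set X | penrose M X]); exists X.
have [r [C [B [defM Cfull Bfree]]]] : exists r (C : 'M[R]_(p, r))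
    (B : 'M[R]_(r, q)), [/\ M = C *m B, row_full C & row_free B].
  exists (\rank M), (col_base M), (row_base M).
  by rewrite mulmx_base col_base_full row_base_free.
have UB : B *m B^T \in unitmx by apply: gram_unitmx.
have UC : C^T *m C \in unitmx.
  by rewrite -{2}[C]trmxK; apply: gram_unitmx; rewrite /row_free mxrank_tr.
pose GB := invmx (B *m B^T); pose GC := invmx (C^T *m C).
have GBT : GB^T = GB by rewrite /GB trmx_inv trmx_mul trmxK.
have GCT : GC^T = GC by rewrite /GC trmx_inv trmx_mul trmxK.
pose X := B^T *m GB *m (GC *m C^T).
have MX : M *m X = C *m GC *m C^T.
  by rewrite defM /X !mulmxA -(mulmxA C B) -(mulmxA C (B *m _)) mulmxV // mulmx1.
have XM : X *m M = B^T *m GB *m B.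
  rewrite defM /X !mulmxA -(mulmxA _ C^T C) -(mulmxA _ GC (C^T *m C)).
  by rewrite mulVmx // mulmx1.
exists X; split.
- rewrite MX defM !mulmxA -(mulmxA _ C^T C) -(mulmxA _ GC (C^T *m C)).
  by rewrite mulVmx // mulmx1.
- rewrite XM /X !mulmxA -(mulmxA _ B B^T) -(mulmxA _ GB (B *m B^T)).
  by rewrite mulVmx // mulmx1.
- by rewrite MX !trmx_mul trmxK GCT mulmxA.
- by rewrite XM !trmx_mul trmxK GBT mulmxA.
Qed.

Definition proper_fun (R : realType) (n : nat) (f : 'cV[R]_n -> \bar R) : Prop :=
  (forall x, f x != -oo%E) /\ (exists x, f x != +oo%E).

(* For f never taking the value -oo, no indeterminate sum occurs. *)
Definition convex_fun (R : realType) (n : nat) (f : 'cV[R]_n -> \bar R) : Prop :=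
  forall (x y : 'cV[R]_n) (t : R), 0 <= t <= 1 ->
    (f (t *: x + (1 - t) *: y)%R <= t%:E * f x + (1 - t)%:E * f y)%E.

Definition fconj (R : realType) (n : nat) (f : 'cV[R]_n -> \bar R)
    (s : 'cV[R]_n) : \bar R :=
  ereal_sup [set ((dotv s x)%:E - f x)%E | x in [set: 'cV[R]_n]].

Definition subdiff (R : realType) (n : nat) (f : 'cV[R]_n -> \bar R)
    (x : 'cV[R]_n) : set 'cV[R]_n :=
  [set s | forall z, (f x + (dotv s (z - x)%R)%:E <= f z)%E].

Definition argmin (R : realType) (T : Type) (h : T -> \bar R) : set T :=
  [set x | forall x', (h x <= h x')%E].

(* The pair (v, y) is stacked as col_mx v y in R^(n+m). *)
Definition kktF (R : realType) (n m : nat) (f : 'cV[R]_n -> \bar R)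
    (g : 'cV[R]_m -> \bar R) (A : 'M[R]_(m, n)) (v : 'cV[R]_n) (y : 'cV[R]_m) :
    set 'cV[R]_(n + m) :=
  [set col_mx (s + A^T *m y) (t - A *m v)
    | s in subdiff f v & t in subdiff (fconj g) y].

Definition kktF_zeros (R : realType) (n m : nat) (f : 'cV[R]_n -> \bar R)
    (g : 'cV[R]_m -> \bar R) (A : 'M[R]_(m, n)) : set 'cV[R]_(n + m) :=
  [set z | kktF f g A (usubmx z) (dsubmx z) 0].

Definition admmP (R : realType) (n m : nat) (tau : R) (A : 'M[R]_(m, n)) :
    'M[R]_(n + m) :=
  block_mx (tau^-1)%:M (- A^T) (- A) (tau *: (A *m A^T)).

(* The w-subproblem is strongly convex, so membership in its set of minimizers
   determines w k.+1; y k.+1 is an arbitrary minimizer.  The value w 0 is not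
   used. *)
Definition is_admm (R : realType) (n m : nat) (f : 'cV[R]_n -> \bar R)
    (g : 'cV[R]_m -> \bar R) (A : 'M[R]_(m, n)) (tau : R)
    (v : nat -> 'cV[R]_n) (y : nat -> 'cV[R]_m) (w : nat -> 'cV[R]_n) : Prop :=
  forall k : nat,
  [/\ argmin (fun u : 'cV[R]_n =>
        (fconj f u - (dotv (A^T *m y k + u)%R (v k))%:E
         + (tau / 2 * l2norm (u + A^T *m y k) ^+ 2)%R%:E)%E) (w k.+1),
      v k.+1 = v k - tau *: (A^T *m y k + w k.+1)
    & argmin (fun u : 'cV[R]_m =>
        (fconj g u - (dotv (A^T *m u + w k.+1)%R (v k.+1))%:E
         + (tau / 2 * l2norm (A^T *m u + w k.+1) ^+ 2)%R%:E)%E) (y k.+1)].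

(* Main.v *)
(* ADMM is the preconditioned proximal point iteration
   P (z_k - z_{k+1}) \in F z_{k+1} for the monotone operator F.  On range P the
   P^- seminorm of P x is the P seminorm of x, so monotonicity gives
     resid (k+1) <= ||z_k - z_{k+1}||_P <= resid k,
   which is (i).  Monotonicity against a zero z_* gives
     ||z_k - z_{k+1}||_P^2 + ||z_{k+1} - z_*||_P^2 <= ||z_k - z_*||_P^2,
   and (ii) follows by summation.  For (iii), summing over K consecutive steps
   from z_j, taking the infimum over all zeros and inserting the error bound
   gives resid (j + K)^2 <= e^-1 resid j^2. *)
Require Import Defs.
From HB Require Import structures.
From mathcomp Require Import all_boot all_order all_algebra.
From mathcomp Require Import all_classical all_reals all_analysis.
From mathcomp Require Import ring lra.

Import Order.TTheory GRing.Theory Num.Theory.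
Import numFieldNormedType.Exports.

Local Open Scope classical_set_scope.
Local Open Scope ring_scope.

(** * Euclidean inner product and its comparison with the sup norm *)

Section inner_product.
Context {R : realType}.

Lemma dotvE n (u v : 'cV[R]_n) : dotv u v = \sum_k u k 0 * v k 0.
Proof. by rewrite /dotv mxE; apply: eq_bigr => k _; rewrite mxE. Qed.

Lemma dotvC n (u v : 'cV[R]_n) : dotv u v = dotv v u.
Proof. by rewrite !dotvE; apply: eq_bigr => k _; rewrite mulrC. Qed.

Lemma dotvDr n (u v w : 'cV[R]_n) : dotv u (v + w) = dotv u v + dotv u w.
Proof. by rewrite /dotv mulmxDr mxE. Qed.

Lemma dotvDl n (u v w : 'cV[R]_n) : dotv (u + v) w = dotv u w + dotv v w.
Proof. by rewrite !(dotvC _ _ w) dotvDr. Qed.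

Lemma dotvNr n (u v : 'cV[R]_n) : dotv u (- v) = - dotv u v.
Proof. by rewrite /dotv mulmxN mxE. Qed.

Lemma dotvNl n (u v : 'cV[R]_n) : dotv (- u) v = - dotv u v.
Proof. by rewrite !(dotvC _ _ v) dotvNr. Qed.

Lemma dotvZr n a (u v : 'cV[R]_n) : dotv u (a *: v) = a * dotv u v.
Proof. by rewrite /dotv -scalemxAr mxE. Qed.

Lemma dotvZl n a (u v : 'cV[R]_n) : dotv (a *: u) v = a * dotv u v.
Proof. by rewrite !(dotvC _ _ v) dotvZr. Qed.

Definition dotv_lin :=
  (dotvDl, dotvDr, dotvNl, dotvNr, dotvZl, dotvZr).

Lemma dotv_ge0 n (u : 'cV[R]_n) : 0 <= dotv u u.
Proof. by rewrite dotvE sumr_ge0 // => k _; rewrite -expr2 sqr_ge0. Qed.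

Lemma dotv_eq0 n (u : 'cV[R]_n) : dotv u u <= 0 -> u = 0.
Proof.
move=> u0; apply/colP => i; rewrite mxE; apply/eqP.
rewrite -[_ == 0]sqrf_eq0 expr2.
have /psumr_eq0P : \sum_k u k 0 * u k 0 = 0.
  by apply/eqP; rewrite -dotvE eq_le u0 dotv_ge0.
by move=> -> // k _; rewrite -expr2 sqr_ge0.
Qed.

Lemma dotv_mulmx m n (A : 'M[R]_(m, n)) u v :
  dotv (A *m u) v = dotv u (A^T *m v).
Proof. by rewrite /dotv trmx_mul mulmxA. Qed.

Lemma dotv_col_mx n m (a b : 'cV[R]_n) (c d : 'cV[R]_m) :
  dotv (col_mx a c) (col_mx b d) = dotv a b + dotv c d.
Proof. by rewrite /dotv tr_col_mx mul_row_col mxE. Qed.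

Lemma l2norm_sqr n (u : 'cV[R]_n) : l2norm u ^+ 2 = dotv u u.
Proof. by rewrite sqr_sqrtr ?dotv_ge0. Qed.

(** The sup norm is attained at some entry, whose square is one of the nonnegative terms of the sum.
    This lets sup-norm balls, which are the compact sets used below, control Euclidean
    quadratics. *)
Lemma normr_sqr_le_dotv n (u : 'cV[R]_n) : `|u| ^+ 2 <= dotv u u.
Proof.
have [->|/mx_norm_neq0[[i j]]] := eqVneq (`|u|) 0.
  by rewrite expr0n dotv_ge0.
rewrite -[mx_norm u]/(`|u|) => -> /=; rewrite (ord1 j) real_normK ?num_real//.
rewrite dotvE (bigD1 i)//= expr2 lerDl sumr_ge0 // => k _.
by rewrite -expr2 sqr_ge0.
Qed.

Lemma dotv_sub_continuous n (c : 'cV[R]_n) :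
  continuous (fun x : 'cV[R]_n => dotv (x - c) (x - c)).
Proof.
rewrite (_ : (fun x : 'cV[R]_n => _) =
  fun x => \sum_k (x k 0 - c k 0) * (x k 0 - c k 0)); last first.
  by apply/funext => x; rewrite dotvE; apply: eq_bigr => k _; rewrite !mxE.
have cD : continuous (fun z : R * R => z.1 + z.2).
  by move=> z; apply: cvgD; [exact: cvg_fst|exact: cvg_snd].
apply: (@continuous_big R 'I_n +%R 0 xpredT cD).
move=> k _ x.
have cx : (z k 0 - c k 0) @[z --> x] --> (x k 0 - c k 0).
  by apply: cvgB; [exact: coord_continuous|exact: cvg_cst].
exact: (cvgM cx cx).
Qed.

End inner_product.

(** * Existence of minimizers of lower semicontinuous functions on compact sets *)

Section minimization.
Context {R : realType}.

(** The sublevel sets in [K] at real levels above the infimum form a proper filter base, which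
    clusters at some [x] by compactness. If [h x] exceeded such a level, semicontinuity would give a
    neighbourhood of [x] missing that sublevel set. *)
Lemma lsc_attains_min (T : topologicalType) (K : set T) (h : T -> \bar R) :
  compact K -> K !=set0 -> lower_semicontinuous h ->
  exists2 x, K x & forall z, K z -> (h x <= h z)%E.
Proof.
move=> cK [x0 Kx0] lsch; set i := ereal_inf (h @` K).
have ile z : K z -> (i <= h z)%E by move=> Kz; apply: ereal_inf_lbound; exists z.
have [iy|niy] := eqVneq i +oo%E.
  exists x0 => // z Kz; have := ile z Kz.
  by rewrite iy leye_eq => /eqP ->; exact: leey.
pose D := [set a : R | (i < a%:E)%E].
pose B (a : R) := K `&` [set x | (h x <= a%:E)%E].
have [a0 Da0] : exists a0, D a0.
  move: niy; rewrite /D; case: (i) => [r| |] // _; last by exists 0; exact: ltNyr.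
  by exists (r + 1); rewrite /= lte_fin ltrDl.
have FF : ProperFilter (filter_from D B).
  apply: filter_from_proper; last first.
    move=> a /ereal_inf_lt[_ [x Kx <-] hxa].
    by exists x; split => //; exact: ltW.
  apply: filter_from_filter; first by exists a0.
  move=> a b Da Db; exists (Num.min a b).
    by rewrite /D /=; case: (leP a b).
  move=> x [Kx /= hx]; split; split => //=; apply: (le_trans hx);
    by rewrite lee_fin ge_min lexx ?orbT.
have [|x [Kx clx]] := cK _ FF; first by exists a0 => // x [].
exists x => // z Kz.
suff xD a : D a -> (h x <= a%:E)%E.
  apply: le_trans (ile z Kz).
  move: niy xD; rewrite /D /=; case: (i) => [r| |] // _ xD.
    by apply/lee_addgt0Pr => e e0; rewrite -EFinD; apply: xD; rewrite lte_fin ltrDl.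
  (* Here the infimum is -oo, so every real is an admissible level and [h x] can only be -oo. *)
  rewrite leeNy_eq; case: (h x) xD => [s| |] // xD; exfalso.
    have := xD (s - 1) (ltNyr _); rewrite lee_fin; lra.
  by have := xD 0 (ltNyr _).
move=> Da; rewrite leNgt; apply/negP => /lsch[V Vx Va].
have [u [[_ /= hua] /Va]] := clx (B a) V (ex_intro2 _ _ a Da (fun _ h => h)) Vx.
by rewrite ltNge hua.
Qed.

Lemma lsc_addr (T : topologicalType) (h : T -> \bar R) (q : T -> R) :
  lower_semicontinuous h -> continuous q ->
  lower_semicontinuous (fun x => (h x + (q x)%:E)%E).
Proof.
move=> lsch cq x a; rewrite -lteBlDr // -EFinB => ah.
(* The slack is split at a real [b]: near [x], [h] stays above [b] and [q] above [a - b]. *)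
have [b [ab bh]] : exists b, a - q x < b /\ (b%:E < h x)%E.
  case: (h x) ah => [r| |] //.
    by rewrite lte_fin => ah; exists ((a - q x + r) / 2); rewrite lte_fin; split; lra.
  by move=> _; exists (a - q x + 1); rewrite ltry; split => //; lra.
have [V Vx Vb] := lsch x b bh.
have Wx : nbhs x [set z | a - b < q z].
  have : nbhs (q x) [set s | a - b < s].
    by apply: lt_nbhsr; lra.
  by move=> /cq.
exists (V `&` [set z | a - b < q z]); first exact: filterI.
move=> z [/Vb bz /= qz]; rewrite -lteBlDr // -EFinB.
by apply: lt_trans bz; rewrite lte_fin; lra.
Qed.

(** The ball is the continuous image, under transposition and translation by [c], of a closed
    bounded ball of row vectors. *)
Lemma ball_cV_compact n (c : 'cV[R]_n) (r : R) :
  compact [set x : 'cV[R]_n | `|x - c| <= r].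
Proof.
have trn p q (M : 'M[R]_(p, q)) : `|M^T| <= `|M|.
  have [->|/mx_norm_neq0[[i j] /=]] := eqVneq (`|M^T|) 0; first exact: normr_ge0.
  rewrite -[mx_norm _]/(`|M^T|) => ->; rewrite mxE.
  rewrite [leRHS]mx_normrE.
  by apply/bigmax_geP; right; exists (j, i).
pose B := [set u : 'rV[R]_n | `|u| <= r].
have cB : compact B.
  apply: bounded_closed_compact.
    exists r; split; first exact: num_real.
    by move=> M rM u /= ur; exact: le_trans ur (ltW rM).
  rewrite (_ : B = (fun u : 'rV[R]_n => `|u|) @^-1` [set s | s <= r]) //.
  apply: closed_comp; last exact: closed_le.
  by move=> u _; exact: norm_continuous.
rewrite (_ : [set x | _] = (fun u : 'rV[R]_n => u^T + c) @` B).
  apply: continuous_compact => //; apply: continuous_subspaceT => u.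
  have ct : t^T @[t --> u] --> u^T.
    move=> s /nbhs_ballP[e e0 es]; apply/nbhs_ballP; exists e => // t [_ ut].
    by apply: es; split => // i j; rewrite !mxE; exact: ut.
  exact: (cvgD ct (cvg_cst _)).
apply/seteqP; split => [x /= xr|_ [u ur <-] /=].
  by exists (x - c)^T; [exact: le_trans (trn _ _ _) xr|rewrite trmxK subrK].
by rewrite addrK; exact: le_trans (trn _ _ _) ur.
Qed.

End minimization.

(** * Proximal points, subdifferentials and conjugates *)

Section convex_analysis.
Context {R : realType} {n : nat}.
Implicit Types (f h : 'cV[R]_n -> \bar R) (x u s : 'cV[R]_n).

(** A minimizer over a large enough ball around a point [x0] of the domain is global: outside the
    ball the objective is at least its value at [x0]. *)
Lemma prox_attained f c : proper_fun f -> lower_semicontinuous f ->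
  convex_fun f ->
  exists u, argmin (fun x => (f x + (2^-1 * dotv (x - c) (x - c))%:E)%E) u.
Proof.
move=> [fNy [x0]] fx0 lscf cvxf.
case ea : (f x0) fx0 (fNy x0) => [a| |] // _ _.
have [|p1 Kp1 minp1] := lsc_attains_min _ _ _ (@ball_cV_compact R n x0 1) _ lscf.
  by exists x0; rewrite /= subrr normr0.
case eb : (f p1) (fNy p1) (minp1 x0) => [b| |] // _; last first.
  by rewrite ea /= subrr normr0 => /(_ ler01).
rewrite ea /= subrr normr0 lee_fin => /(_ ler01) ba.
(* Boundedness below on the unit ball around [x0] extends, by convexity along
   rays, to linear growth at worst, which the quadratic term dominates. *)
have low x F : 1 <= `|x - x0| -> f x = F%:E -> a - (a - b) * `|x - x0| <= F.
  move=> rho1 eF; set rho := `|x - x0| in rho1 *.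
  have rho0 : 0 < rho by lra.
  have rV0 : 0 < rho^-1 by rewrite invr_gt0.
  have rV1 : rho^-1 <= 1 by rewrite invf_le1.
  have := cvxf x x0 rho^-1; rewrite rV1 ltW // => /(_ isT).
  have : (f p1 <= f (rho^-1 *: x + (1 - rho^-1) *: x0)%R)%E.
    apply: minp1 => /=.
    rewrite (_ : _ - x0 = rho^-1 *: (x - x0)); last first.
      by rewrite scalerBl scale1r -addrA [_ - _ - x0]addrAC subrr add0r scalerBr.
    by rewrite normrZ gtr0_norm // mulVf // gt_eqF.
  move=> /le_trans/[apply]; rewrite eb eF ea -!EFinM -EFinD lee_fin => bF.
  have := ler_wpM2l (ltW rho0) bF.
  rewrite mulrDr !mulrA mulfV ?gt_eqF // mulrBr mulfV ?gt_eqF // mulr1 mul1r.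
  lra.
pose q x : R := 2^-1 * dotv (x - c) (x - c).
have lsch : lower_semicontinuous (fun x => (f x + (q x)%:E)%E).
  apply: lsc_addr => // x.
  exact: (cvgM (cvg_cst _) (dotv_sub_continuous n c x)).
pose delta := `|x0 - c|; pose q0 := dotv (x0 - c) (x0 - c).
have d0 : 0 <= delta by exact: normr_ge0.
have q00 : 0 <= q0 by exact: dotv_ge0.
(* For [rho] beyond [r], the linear lower bound on [f] and [(rho - delta) ^+ 2 <= D] reduce the
   claim to [q0 <= rho * (rho - 2 * delta - 2 * (a - b))]. This radius makes the first factor at
   least 1 and the second at least [q0]. *)
pose r := 1 + 2 * delta + 2 * (a - b) + q0.
have r0 : 0 <= r by rewrite /r; lra.
have [|u Ku minu] := lsc_attains_min _ _ _ (@ball_cV_compact R n x0 r) _ lsch.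
  by exists x0; rewrite /= subrr normr0.
exists u => z; have [zr|rz] := leP (`|z - x0|) r; first exact: minu.
case ez : (f z) (fNy z) => [F| |] // _; last by rewrite addye // leey.
apply: (@le_trans _ _ (f x0 + (q x0)%:E)%E).
  by apply: minu; rewrite /= subrr normr0.
rewrite ea -!EFinD lee_fin /q -/q0.
have := @low z F; set rho := `|z - x0| in rz *.
have : rho <= delta + `|z - c|.
  rewrite /rho /delta (_ : z - x0 = - (x0 - c) + (z - c)).
    by apply: le_trans (ler_normD _ _) _; rewrite normrN.
  by rewrite opprB [RHS]addrC addrA subrK.
have := @normr_sqr_le_dotv R n (z - c); set D := dotv _ _; set N := `|z - c|.
have N0 : 0 <= N by exact: normr_ge0.
move=> ND rN /(_ _ ez) lowF.
have {}lowF := lowF ltac:(rewrite /r in rz; lra).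
have {}rz : 1 + 2 * delta + 2 * (a - b) + q0 <= rho by rewrite ltW.
have : (rho - delta) ^+ 2 <= N ^+ 2 by apply: lerXn2r; rewrite ?nnegrE; lra.
have : q0 <= rho * (rho - 2 * delta - 2 * (a - b)).
  apply: (@le_trans _ _ (1 * q0)); first by rewrite mul1r.
  by apply: ler_pM; lra.
rewrite !expr2 in ND *; have := mulr_ge0 d0 d0; lra.
Qed.

(** First-order optimality, with [s] in the role of minus the gradient of [q] at [u]. Along the
    segment from [u] to [z], convexity bounds the change of [h] linearly in [t], so a violated
    subgradient inequality would beat the term in [t ^+ 2] for small [t]. *)
Lemma argmin_subdiff h (q : 'cV[R]_n -> R) u s :
  proper_fun h -> convex_fun h ->
  argmin (fun x => (h x + (q x)%:E)%E) u ->
  (forall d, exists C, forall t,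
    q (u + t *: d) = q u - t * dotv s d + t ^+ 2 * C) ->
  subdiff h u s.
Proof.
move=> [hNy [x1 hx1]] cvxh minu qE z.
case eb : (h z) (hNy z) => [b| |] // _; last exact: leey.
case ea : (h u) (hNy u) => [a| |] // _; last first.
  by have := minu x1; rewrite ea; case: (h x1) hx1 (hNy x1).
rewrite -EFinD lee_fin; have [C qC] := qE (z - u).
rewrite leNgt; apply/negP => lt0.
set e := a + dotv s (z - u) - b.
have e0 : 0 < e by rewrite /e; lra.
have C0 := normr_ge0 C.
(* A step in the unit interval with [t * C < e], whereas minimality and convexity force
   [e <= t * C]. *)
pose t := e / (e + `|C|).
have eC : 0 < e + `|C| by lra.
have t0 : 0 < t by rewrite divr_gt0.
have t1 : t <= 1 by rewrite ler_pdivrMr // mul1r lerDl.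
have tE : t * e + t * `|C| = e by rewrite -mulrDr /t mulfVK // gt_eqF.
have tC : t * C < e.
  by have := ler_wpM2l (ltW t0) (ler_norm C); have := mulr_gt0 t0 e0; lra.
have := cvxh z u t; rewrite t1 ltW // => /(_ isT).
have -> : t *: z + (1 - t) *: u = u + t *: (z - u).
  by rewrite scalerBl scale1r scalerBr addrCA.
have := minu (u + t *: (z - u)).
rewrite ea eb qC; set w := u + _.
case: (h w) (hNy w) => [c| |] // _.
rewrite -!EFinM -!EFinD !lee_fin => m1 m2.
have : t * e <= t * (t * C) by rewrite /e mulrA -expr2; lra.
by rewrite ler_pM2l //; lra.
Qed.

Lemma subdiff_fin f x s : proper_fun f -> subdiff f x s ->
  exists a, f x = a%:E.
Proof.
move=> [fNy [z fz]] /(_ z).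
case: (f x) (fNy x) => [a| |] // _; first by exists a.
by case: (f z) fz (fNy z) => // r _ _; rewrite addye // leye_eq.
Qed.

Lemma subdiff_monotone f x1 x2 s1 s2 : proper_fun f ->
  subdiff f x1 s1 -> subdiff f x2 s2 -> 0 <= dotv (s1 - s2) (x1 - x2).
Proof.
move=> pf d1 d2; have [a1 e1] := subdiff_fin _ _ _ pf d1.
have [a2 e2] := subdiff_fin _ _ _ pf d2.
have := d1 x2; have := d2 x1; rewrite e1 e2 -!EFinD !lee_fin !dotv_lin; lra.
Qed.

(** The Fenchel-Young inequality at a point where [f] is finite; the next lemma gives its equality
    case. *)
Lemma fconj_ge f s x a : f x = a%:E -> ((dotv s x - a)%:E <= fconj f s)%E.
Proof. by move=> e; apply: ereal_sup_ubound; exists x => //; rewrite e. Qed.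

Lemma subdiff_fconj_le f u s a : proper_fun f -> f u = a%:E ->
  subdiff f u s -> (fconj f s <= (dotv s u - a)%:E)%E.
Proof.
move=> [fNy _] ea d; apply: ge_ereal_sup => _ [z _ <-].
have := d z; rewrite ea; case: (f z) (fNy z) => [b| |] // _; last first.
  by move=> _; rewrite leNye.
by rewrite -!EFinD !lee_fin !dotv_lin; lra.
Qed.

(** Fenchel-Young at [z] is compared with its equality case at [s]. *)
Lemma subdiff_fconj f u s : proper_fun f -> subdiff f u s ->
  subdiff (fconj f) s u.
Proof.
move=> pf d z; have [a ea] := subdiff_fin _ _ _ pf d.
apply: le_trans (fconj_ge f z u a ea).
have := subdiff_fconj_le _ _ _ _ pf ea d => /leeD2r-/(_ (dotv u (z - s))%:E).
move=> /le_trans; apply; rewrite -EFinD lee_fin !dotv_lin.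
rewrite (dotvC _ u s) (dotvC _ u z); lra.
Qed.

Lemma convex_fconj f : proper_fun f -> convex_fun (fconj f).
Proof.
move=> [fNy _] x y t /andP[t0 t1]; apply: ge_ereal_sup => _ [z _ <-].
case ea : (f z) (fNy z) => [a| |] // _; last by rewrite leNye.
have t1' : 0 <= 1 - t by lra.
apply: (@le_trans _ _
  (t%:E * (dotv x z - a)%:E + (1 - t)%:E * (dotv y z - a)%:E)%E).
  by rewrite -!EFinM -!EFinD lee_fin !dotv_lin; lra.
by apply: leeD; apply: lee_wpmul2l; rewrite ?lee_fin //; exact: fconj_ge.
Qed.

(** Minty surjectivity of the identity plus [subdiff f]: this is the optimality condition of the
    proximal problem at [c]. *)
Lemma prox_subdiff f c : proper_fun f -> lower_semicontinuous f ->
  convex_fun f -> exists u, subdiff f u (c - u).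
Proof.
move=> pf lf cf; have [u minu] := prox_attained f c pf lf cf.
exists u; apply: (argmin_subdiff _ _ _ _ pf cf minu) => d.
exists (2^-1 * dotv d d) => t; rewrite !dotv_lin.
rewrite (dotvC _ c u) (dotvC _ d u) (dotvC _ d c); lra.
Qed.

(** The proximal point [u] of 0 has subgradient [0 - u]. Finiteness of [f] at [u] keeps the
    conjugate above -oo everywhere, and the equality case of Fenchel-Young bounds it above at
    [0 - u]. *)
Lemma proper_fconj f : proper_fun f -> lower_semicontinuous f ->
  convex_fun f -> proper_fun (fconj f).
Proof.
move=> pf lf cf; have [u du] := prox_subdiff f 0 pf lf cf.
have [a ea] := subdiff_fin _ _ _ pf du; split=> [s|].
  by have := fconj_ge f s u a ea; case: (fconj f s).
exists (0 - u); have := subdiff_fconj_le _ _ _ _ pf ea du.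
by case: (fconj f _).
Qed.

(* Inverting the subdifferential of the conjugate without the biconjugate
   theorem: the resolvent of [subdiff f] at [v + w] must be [v] because
   [subdiff (fconj f)] is monotone. *)
Lemma fconj_subdiff f v w : proper_fun f -> lower_semicontinuous f ->
  convex_fun f -> subdiff (fconj f) w v -> subdiff f v w.
Proof.
move=> pf lf cf dv; have [u du] := prox_subdiff f (v + w) pf lf cf.
have := subdiff_monotone _ _ _ _ _ (proper_fconj f pf lf cf) dv
  (subdiff_fconj _ _ _ pf du).
have -> : w - (v + w - u) = - (v - u).
  by rewrite !opprB opprD [LHS]addrC !addrA subrK.
rewrite dotvNr oppr_ge0 => /dotv_eq0/subr0_eq vu; move: du.
by rewrite -vu addrAC subrr add0r.
Qed.

End convex_analysis.

(** * Matrix seminorms, the pseudo-inverse and distances *)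

Lemma mxnorm_sqr (R : realType) (p : nat) (M : 'M[R]_p) (u : 'cV[R]_p) :
  (forall x : 'cV[R]_p, 0 <= dotv x (M *m x)) ->
  mxnorm M u ^+ 2 = dotv u (M *m u).
Proof. by move=> psd; rewrite sqr_sqrtr. Qed.

Lemma mxnorm_pinv (R : realType) (p : nat) (M : 'M[R]_p) (u : 'cV[R]_p) :
  M^T = M -> mxnorm (mp_pinv M) (M *m u) = mxnorm M u.
Proof.
move=> symM; have [MXM _ _ _] := penrose_mp_pinv M.
by rewrite /mxnorm dotv_mulmx symM !mulmxA MXM.
Qed.

Lemma mxnorm_subC (R : realType) (p : nat) (M : 'M[R]_p) (u v : 'cV[R]_p) :
  mxnorm M (u - v) = mxnorm M (v - u).
Proof. by rewrite /mxnorm -opprB mulmxN dotvNl dotvNr opprK. Qed.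

Lemma mxdist_ge0 {R : realType} {p : nat} (M : 'M[R]_p) z S :
  (0 <= mxdist M z S)%E.
Proof. by apply: le_ereal_inf_tmp => _ [u _ <-]; rewrite lee_fin sqrtr_ge0. Qed.

Lemma lee_sqr {R : realType} {a b : \bar R} :
  (0 <= a)%E -> (a <= b)%E -> (a ^+ 2 <= b ^+ 2)%E.
Proof. by move=> a0 ab; rewrite !expe2; apply: lee_pmul. Qed.

(** * The preconditioned proximal point iteration for a monotone operator *)

Section proximal_point.
Context {R : realType} {p : nat}.
Variables (T : 'cV[R]_p -> set 'cV[R]_p) (M : 'M[R]_p) (z : nat -> 'cV[R]_p).
Hypothesis symM : M^T = M.
Hypothesis psdM : forall x : 'cV[R]_p, 0 <= dotv x (M *m x).
Hypothesis monoT : forall a b u v,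
  T a u -> T b v -> 0 <= dotv (u - v) (a - b).
Hypothesis stepT : forall k, T (z k.+1) (M *m (z k - z k.+1)).

Local Notation resid k := (mxdist (mp_pinv M) 0 (T (z k) `&` mxrange M)).
Local Notation d k := (mxnorm M (z k - z k.+1)).

Lemma ppa_resid_le k : (resid k.+1 <= (d k)%:E)%E.
Proof.
apply: ereal_inf_lbound; exists (M *m (z k - z k.+1)).
  by split; [exact: stepT|exists (z k - z k.+1)].
by rewrite subr0 mxnorm_pinv.
Qed.

(** With [e] the step, monotonicity between [M *m x] and [M *m e] bounds the [M]-product of [x] and
    [e] below by that of [e] with itself. Nonnegativity of the form at [x - e] then gives the
    comparison of seminorms. *)
Lemma ppa_le_resid k : ((d k)%:E <= resid k)%E.
Proof.
apply: le_ereal_inf_tmp => _ [u [Tu [x _ xu]] <-].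
move: Tu; rewrite -{u}xu => Tu; rewrite subr0 mxnorm_pinv // lee_fin ler_sqrt //.
have := monoT _ _ _ _ Tu (stepT k).
have := psdM (x - (z k - z k.+1)).
move: (z k - z k.+1) => e.
have sym a b : dotv (M *m a) b = dotv a (M *m b) by rewrite dotv_mulmx symM.
rewrite mulmxBr !dotv_lin !sym (dotvC _ e (M *m x)) sym; lra.
Qed.

(** Expanding the square around [z k.+1] leaves a cross term that monotonicity against the zero
    makes nonnegative. *)
Lemma ppa_fejer zs k : T zs 0 ->
  d k ^+ 2 + mxnorm M (z k.+1 - zs) ^+ 2 <= mxnorm M (z k - zs) ^+ 2.
Proof.
move=> Tzs; rewrite !mxnorm_sqr //.
have := monoT _ _ _ _ (stepT k) Tzs; rewrite subr0.
have -> : z k - zs = (z k - z k.+1) + (z k.+1 - zs) by rewrite addrA subrK.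
move: (z k - z k.+1) (z k.+1 - zs) => e h.
have sym a b : dotv (M *m a) b = dotv a (M *m b) by rewrite dotv_mulmx symM.
rewrite mulmxDr !dotv_lin (dotvC _ h (M *m e)) !sym; lra.
Qed.

Lemma ppa_step_nonincreasing k : d k.+1 <= d k.
Proof. by rewrite -lee_fin; apply: le_trans (ppa_le_resid _) (ppa_resid_le k). Qed.

Lemma ppa_rate zs j K : T zs 0 ->
  K.+1%:R * d (j + K)%N ^+ 2 <= mxnorm M (z j - zs) ^+ 2.
Proof.
(* The distance after the last step is kept so that the induction telescopes; since steps do not
   grow, each of the [K.+1] steps is at least as long as the last. *)
move=> Tzs; suff : K.+1%:R * d (j + K)%N ^+ 2 + mxnorm M (z (j + K).+1 - zs) ^+ 2
    <= mxnorm M (z j - zs) ^+ 2.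
  by have := sqr_ge0 (mxnorm M (z (j + K).+1 - zs)); lra.
elim: K => [|K IH]; first by rewrite addn0 mul1r; exact: ppa_fejer.
rewrite addnS; apply: le_trans IH; have := ppa_fejer zs (j + K).+1 Tzs.
have : d (j + K).+1 ^+ 2 <= d (j + K)%N ^+ 2.
  by apply: lerXn2r; rewrite ?nnegrE ?sqrtr_ge0 // ppa_step_nonincreasing.
move=> /(ler_wpM2l (ler0n R K.+1)); rewrite -[K.+2]addn1 natrD; lra.
Qed.

Lemma ppa_resid_nonincreasing :
  {homo (fun k => resid k) : i j / (i <= j)%N >-> (j <= i)%E}.
Proof.
apply: homo_leq => [x|x y w /[swap]|k]; [exact: lexx|exact: le_trans|].
exact: le_trans (ppa_resid_le k) (ppa_le_resid k).
Qed.

Lemma ppa_resid_sqr_rate zs k : T zs 0 -> (0 < k)%N ->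
  (resid k ^+ 2 <= (k%:R^-1 * mxnorm M (z 0%N - zs) ^+ 2)%:E)%E.
Proof.
case: k => // k Tzs _.
apply: le_trans (lee_sqr (mxdist_ge0 _ _ _) (ppa_resid_le k)) _.
rewrite -EFin_expe lee_fin ler_pdivlMl ?ltr0Sn //.
exact: ppa_rate zs 0%N k Tzs.
Qed.

(** * Linear rate under the error bound, in blocks of [K.+1] steps *)

Section error_bound.
Variables (alpha : R) (K : nat).
Hypothesis alpha_gt0 : 0 < alpha.
Hypothesis errb : forall k,
  (alpha%:E * mxdist M (z k) [set x | T x 0%R] <=
   mxdist (mp_pinv M) 0 (T (z k)))%E.
Hypothesis K_large : expR 1 <= alpha ^+ 2 * K.+1%:R.

Lemma ppa_contraction j :
  (resid (j + K.+1)%N ^+ 2 <= (expR (-1))%:E * resid j ^+ 2)%E.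
Proof.
(* The error bound concerns unsquared distances, so the block length enters through its square
   root. *)
have [s s0 s2] : exists2 s : R, 0 <= s & s ^+ 2 = K.+1%:R.
  by exists (Num.sqrt K.+1%:R); rewrite ?sqrtr_ge0 ?sqr_sqrtr.
have le_dist : ((s * d (j + K)%N)%:E <= mxdist M (z j) [set x | T x 0%R])%E.
  apply: le_ereal_inf_tmp => _ [zs Tzs <-]; rewrite lee_fin.
  rewrite -ler_sqr ?nnegrE ?mulr_ge0 ?sqrtr_ge0 // exprMn s2.
  by rewrite (mxnorm_subC _ _ M zs); exact: (ppa_rate zs j K Tzs).
(* The error bound involves all of [T (z j)]; restricting to the range of [M] only raises the
   infimum. *)
have sub : (mxdist (mp_pinv M) 0 (T (z j)) <= resid j)%E.
  by apply: ereal_inf_le_tmp; apply: image_subset; exact: subIsetl.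
have bnd : ((alpha * (s * d (j + K)%N))%:E <= resid j)%E.
  apply: le_trans sub; apply: le_trans (errb j); rewrite EFinM.
  by apply: lee_wpmul2l => //; rewrite lee_fin ltW.
rewrite addnS; apply: le_trans (lee_sqr (mxdist_ge0 _ _ _) (ppa_resid_le _)) _.
have := mxdist_ge0 (mp_pinv M) 0 (T (z j) `&` mxrange M).
case: (resid j) bnd => [r| |] //; last first.
  by move=> _ _; rewrite [(+oo ^+ 2)%E]expe2 mulyy gt0_muley ?lte_fin ?expR_gt0 ?leey.
rewrite !lee_fin => bnd r0.
rewrite -!expr2 expRN ler_pdivlMl ?expR_gt0 //.
have dd := sqr_ge0 (d (j + K)%N).
apply: le_trans (ler_wpM2r dd K_large) _.
rewrite -s2 -!exprMn -mulrA.
apply: lerXn2r; rewrite ?nnegrE //.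
by rewrite mulr_ge0 ?mulr_ge0 ?sqrtr_ge0 // ltW.
Qed.

Lemma ppa_linear_rate k :
  (resid k ^+ 2 <= (expR (1 - k%:R / K.+1%:R))%:E * resid 0%N ^+ 2)%E.
Proof.
(* Write [k] as [q] full blocks plus a remainder [i]: each block contributes a factor [expR (-1)],
   and the first [i] steps do not increase the residual. *)
have iterq q i :
    (resid (q * K.+1 + i)%N ^+ 2 <= (expR (- q%:R))%:E * resid i ^+ 2)%E.
  elim: q => [|q IH]; first by rewrite oppr0 expR0 mul1e.
  rewrite mulSnr addnAC; apply: le_trans (ppa_contraction _) _.
  rewrite -natr1 opprD addrC expRD EFinM -muleA.
  by apply: lee_wpmul2l => //; rewrite lee_fin expR_ge0.
rewrite {1}(divn_eq k K.+1); apply: le_trans (iterq _ _) _.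
apply: lee_pmul; rewrite ?lee_fin ?expR_ge0 //.
- by rewrite expe2 mule_ge0 // mxdist_ge0.
(* The quotient falls short of [k / K.+1] by at most 1, which is the 1 in the exponent. *)
- have : k%:R / K.+1%:R <= (k %/ K.+1)%:R + 1 :> R.
    by rewrite ler_pdivrMr ?ltr0Sn // natr1 -natrM ler_nat ltnW // ltn_ceil.
  by rewrite ler_expR lerNl opprB lerBlDr.
- by apply: lee_sqr; [exact: mxdist_ge0|exact: ppa_resid_nonincreasing].
Qed.

End error_bound.
End proximal_point.

(** * The ADMM preconditioner, the KKT operator and the augmented quadratic *)

Lemma admmP_sym (R : realType) (n m : nat) (tau : R) (A : 'M[R]_(m, n)) :
  (admmP tau A)^T = admmP tau A.
Proof.
by rewrite /admmP tr_block_mx tr_scalar_mx linearZ /= trmx_mul !linearN /= !trmxK.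
Qed.

(** Completing the square: the form equals [tau^-1] times the squared Euclidean norm of
    [a - tau *: (A^T *m b)]. *)
Lemma admmP_psd (R : realType) (n m : nat) (tau : R) (A : 'M[R]_(m, n))
  (z : 'cV[R]_(n + m)) : 0 < tau -> 0 <= dotv z (admmP tau A *m z).
Proof.
move=> tau0; rewrite -(vsubmxK z); set a := usubmx z; set b := dsubmx z.
rewrite /admmP mul_block_col mul_scalar_mx -scalemxAl -mulmxA !mulNmx.
have bA x : dotv b (A *m x) = dotv x (A^T *m b) by rewrite dotvC dotv_mulmx.
rewrite dotv_col_mx !dotv_lin !bA; set c := A^T *m b.
have -> : tau^-1 * dotv a a + - dotv a c + (- dotv a c + tau * dotv c c)
    = tau^-1 * dotv (a - tau *: c) (a - tau *: c).
  by rewrite !dotv_lin (dotvC n c a); field; rewrite gt_eqF.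
by rewrite mulr_ge0 ?dotv_ge0 // invr_ge0 ltW.
Qed.

(** Both subdifferentials are monotone, and the terms in [A] form a skew map whose contributions
    cancel. *)
Lemma kktF_monotone (R : realType) (n m : nat)
    (f : 'cV[R]_n -> \bar R) (g : 'cV[R]_m -> \bar R) (A : 'M[R]_(m, n))
    (v1 v2 : 'cV[R]_n) (y1 y2 : 'cV[R]_m) (u1 u2 : 'cV[R]_(n + m)) :
  proper_fun f -> proper_fun (fconj g) ->
  kktF f g A v1 y1 u1 -> kktF f g A v2 y2 u2 ->
  0 <= dotv (u1 - u2) (col_mx v1 y1 - col_mx v2 y2).
Proof.
move=> pf pg [s1 ds1 [t1 dt1 <-]] [s2 ds2 [t2 dt2 <-]].
have := subdiff_monotone _ _ _ _ _ pf ds1 ds2.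
have := subdiff_monotone _ _ _ _ _ pg dt1 dt2.
have adj v y : dotv (A *m v) y = dotv (A^T *m y) v by rewrite dotv_mulmx dotvC.
rewrite !opp_col_mx !add_col_mx dotv_col_mx !dotv_lin !adj; lra.
Qed.

(** The smooth part shared by both subproblems, in the shape asked for by [argmin_subdiff]; it
    exhibits [v - tau *: x] as minus the gradient. *)
Lemma augmented_expansion (R : realType) (n : nat) (tau : R)
    (v x e : 'cV[R]_n) (t : R) :
  - dotv (x + t *: e) v + tau / 2 * l2norm (x + t *: e) ^+ 2 =
  - dotv x v + tau / 2 * l2norm x ^+ 2 - t * dotv (v - tau *: x) e
  + t ^+ 2 * (tau / 2 * dotv e e).
Proof.
rewrite !l2norm_sqr !dotv_lin (dotvC _ e v) (dotvC _ e x) (dotvC _ x v); lra.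
Qed.

(** * ADMM steps as proximal point steps *)

Section admm.
Context {R : realType} {n m : nat}.
Variables (f : 'cV[R]_n -> \bar R) (g : 'cV[R]_m -> \bar R) (A : 'M[R]_(m, n)).
Hypotheses (f_proper : proper_fun f) (f_lsc : lower_semicontinuous f)
  (f_convex : convex_fun f).
Hypotheses (g_proper : proper_fun g) (g_lsc : lower_semicontinuous g)
  (g_convex : convex_fun g).
Variables (tau : R) (v : nat -> 'cV[R]_n) (y : nat -> 'cV[R]_m)
  (w : nat -> 'cV[R]_n).
Hypothesis tau_gt0 : 0 < tau.
Hypothesis admm : is_admm f g A tau v y w.

(** Optimality of [w k.+1] puts [v k - tau *: (A^T *m y k + w k.+1)], which is [v k.+1], in the
    subdifferential of the conjugate of [f]; inversion then returns to [f]. *)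
Lemma admm_primal k : subdiff f (v k.+1) (w k.+1).
Proof.
have [minw vE _] := admm k.
apply: fconj_subdiff => //.
apply: (argmin_subdiff _ (fun u => - dotv (A^T *m y k + u) (v k)
    + tau / 2 * l2norm (u + A^T *m y k) ^+ 2)).
- exact: proper_fconj.
- exact: convex_fconj.
- by move=> u; have := minw u; rewrite -!addeA -!EFinN -!EFinD.
move=> d; exists (tau / 2 * dotv d d) => t.
by rewrite !(addrC _ (A^T *m _)) addrA augmented_expansion -vE.
Qed.

(** The optimality condition of the [y]-subproblem, with [A] appearing as the adjoint of the map
    [A^T] inside the quadratic. *)
Lemma admm_dual k : subdiff (fconj g) (y k.+1)
  (A *m (v k.+1 - tau *: (A^T *m y k.+1 + w k.+1))).
Proof.
have [_ _ miny] := admm k.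
apply: (argmin_subdiff _ (fun u => - dotv (A^T *m u + w k.+1) (v k.+1)
    + tau / 2 * l2norm (A^T *m u + w k.+1) ^+ 2)).
- exact: proper_fconj.
- exact: convex_fconj.
- by move=> u; have := miny u; rewrite -!addeA -!EFinN -!EFinD.
move=> d; exists (tau / 2 * dotv (A^T *m d) (A^T *m d)) => t.
by rewrite mulmxDr -scalemxAr addrAC augmented_expansion dotv_mulmx.
Qed.

(** The two optimality conditions supply the subgradients; substituting [v k - v k.+1 = tau *: (A^T
    *m y k + w k.+1)] cancels the terms in [y k] in both blocks. *)
Lemma admm_ppa_step k : kktF f g A (v k.+1) (y k.+1)
  (admmP tau A *m (col_mx (v k) (y k) - col_mx (v k.+1) (y k.+1))).
Proof.
have [_ vE _] := admm k.
exists (w k.+1); first exact: admm_primal.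
exists (A *m (v k.+1 - tau *: (A^T *m y k.+1 + w k.+1))); first exact: admm_dual.
have dv : v k - v k.+1 = tau *: (A^T *m y k + w k.+1).
  by rewrite vE opprB addrC subrK.
rewrite opp_col_mx add_col_mx /admmP mul_block_col mul_scalar_mx !mulNmx.
rewrite -scalemxAl -mulmxA (mulmxBr A^T) dv scalerA mulVf ?gt_eqF // scale1r.
congr col_mx; first by rewrite opprB [RHS]addrC addrA subrK addrC.
rewrite mulmxBr addrAC subrr add0r -!scalemxAr [RHS]addrC -scalerBr.
rewrite -(mulmxBr A).
by rewrite opprD addrACA subrr add0r -opprD mulmxN scalerN.
Qed.

End admm.


Theorem theorem7 (R : realType) (n m : nat)
    (f : 'cV[R]_n -> \bar R) (g : 'cV[R]_m -> \bar R) (A : 'M[R]_(m, n))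
    (f_proper : proper_fun f) (f_lsc : lower_semicontinuous f)
    (f_convex : convex_fun f)
    (g_proper : proper_fun g) (g_lsc : lower_semicontinuous g)
    (g_convex : convex_fun g)
    (vs : 'cV[R]_n) (ys : 'cV[R]_m)
    (opt : kktF_zeros f g A (col_mx vs ys))
    (tau : R) (tau_gt0 : 0 < tau)
    (v : nat -> 'cV[R]_n) (y : nat -> 'cV[R]_m) (w : nat -> 'cV[R]_n)
    (admm : is_admm f g A tau v y w) :
  let P := admmP tau A in
  let resid k :=
    mxdist (mp_pinv P) 0 (kktF f g A (v k) (y k) `&` mxrange P) in
  [/\ (forall k : nat, (1 <= k)%N ->
         (resid k.+1 ^+ 2 <= resid k ^+ 2)%E),
      (forall k : nat, (1 <= k)%N ->
         (resid k ^+ 2 <=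
          (k%:R^-1 * mxnorm P (col_mx (v 0%N) (y 0%N) - col_mx vs ys) ^+ 2)%R%:E)%E)
    & (forall (alpha : R) (S : set 'cV[R]_(n + m)),
         0 < alpha ->
         (forall k : nat, S (col_mx (v k) (y k))) ->
         (forall (v' : 'cV[R]_n) (y' : 'cV[R]_m), S (col_mx v' y') ->
            (alpha%:E * mxdist P (col_mx v' y') (kktF_zeros f g A) <=
             mxdist (mp_pinv P) 0 (kktF f g A v' y'))%E) ->
         let K := Num.ceil (expR 1 / alpha ^+ 2) in
         forall k : nat, (K <= k%:Z)%R ->
           (resid k ^+ 2 <=
            (expR (1 - k%:R / K%:~R))%:E * resid 0%N ^+ 2)%E)].
Proof.
move=> P resid.
pose z k := col_mx (v k) (y k).
pose T (x : 'cV[R]_(n + m)) := kktF f g A (usubmx x) (dsubmx x).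
have TE k : T (z k) = kktF f g A (v k) (y k) by rewrite /T col_mxKu col_mxKd.
have residE k : resid k = mxdist (mp_pinv P) 0 (T (z k) `&` mxrange P).
  by rewrite /resid TE.
have symP : P^T = P := admmP_sym _ _ _ tau A.
have psdP x : 0 <= dotv x (P *m x) := admmP_psd _ _ _ tau A x tau_gt0.
have monoT a b r s : T a r -> T b s -> 0 <= dotv (r - s) (a - b).
  move=> Ta Tb; rewrite -(vsubmxK a) -(vsubmxK b).
  apply: kktF_monotone Ta Tb => //; exact: proper_fconj.
have stepT k : T (z k.+1) (P *m (z k - z k.+1)).
  by rewrite TE; apply: (@admm_ppa_step R n m f g A _ _ _ _ _ _ tau v y w).
split.
- move=> k _; rewrite !residE; apply: lee_sqr; first exact: mxdist_ge0.
  exact: (ppa_resid_nonincreasing T P z symP psdP monoT stepT).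
- by move=> k k0; rewrite residE; apply: (ppa_resid_sqr_rate T P z).
move=> alpha S alpha0 Sz errb K k _.
have errz j : (alpha%:E * mxdist P (z j) [set x | T x 0%R]
    <= mxdist (mp_pinv P) 0 (T (z j)))%E.
  by rewrite TE; exact: errb.
have e0 : 0 < expR 1 / alpha ^+ 2 by rewrite divr_gt0 ?expR_gt0 ?exprn_gt0.
have : (0 < K)%R by rewrite ceil_gt0.
have : expR 1 / alpha ^+ 2 <= K%:~R by exact: ceil_ge.
(* The ceiling of a positive real is a positive integer, hence a successor, as the block length
   [K.+1] requires. *)
case: K => [[|K]|] // KE _.
rewrite !residE; apply: (ppa_linear_rate T P z symP psdP monoT stepT alpha) => //.
by move: KE; rewrite ler_pdivrMr ?exprn_gt0 // mulrC.
Qed.
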